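(* Let $N\ge 0$, $\alpha>0$, and let $p(\theta)=\frac{\alpha}{2}+\sum_{k=0}^{N}\big(a_{2k+1}\cos(2k+1)\theta+b_{2k+1}\sin(2k+1)\theta\big)$ be a real trigonometric polynomial satisfying $p(\theta)+p''(\theta)\geq 0$ for all $\theta$, with $a_{2N+1}\neq 0$ or $b_{2N+1}\neq 0$. Let $\mathcal{C}$ be the curve parametrized by $\theta\in[-\pi,\pi]\mapsto\big(p(\theta)\cos\theta-p'(\theta)\sin\theta,\ p(\theta)\sin\theta+p'(\theta)\cos\theta\big)$ (an algebraic curve of constant width $\alpha$), and assume $\mathcal{C}$ is not a circle. Then its defining polynomial $f\in\mathbb{R}[x,y]$ has total degree $4N+4$, and moreover $\deg_x(f)=\deg_y(f)=4N+4$.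
   Context: The defining polynomial of the curve $\mathcal{C}$ is the irreducible polynomial $f\in\mathbb{R}[x,y]$, unique up to a nonzero constant factor, whose zero set is the Zariski closure of $\mathcal{C}$. $\deg_x,\deg_y$ denote partial degrees. *)

(* Defs.v *)
From HB Require Import structures.
From mathcomp Require Import all_boot all_order all_algebra.
From mathcomp Require Import all_classical all_reals all_analysis.
From mathcomp Require mpoly.
Import (canonicals) mpoly.
Set Implicit Arguments. Unset Strict Implicit. Unset Printing Implicit Defensive.
Import Order.TTheory GRing.Theory Num.Theory.
Local Open Scope ring_scope.
Local Open Scope classical_set_scope.

(* Real bivariate polynomials R[x,y]: variable 0 is x, variable 1 is y. *)
Notation bipoly R := (mpoly.mpoly 2 R).

Definition bieval (R : realType) (f : bipoly R) (z : R * R) : R :=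
  mpoly.meval (fun i : 'I_2 => if val i == 0%N then z.1 else z.2) f.

Definition totdeg (R : realType) (f : bipoly R) : nat :=
  (\max_(m <- mpoly.msupp f) mpoly.mdeg m)%N.
Definition pdeg (R : realType) (i : 'I_2) (f : bipoly R) : nat :=
  (\max_(m <- mpoly.msupp f) mpoly.fun_of_multinom m i)%N.
Definition deg_x (R : realType) (f : bipoly R) := pdeg (@ord0 1) f.
Definition deg_y (R : realType) (f : bipoly R) := pdeg (@ord_max 1) f.

(* irreducible element of R[x,y]: non-constant, and not a product of two
   non-constant polynomials (units of R[x,y] are the nonzero constants). *)
Definition irreducible_bipoly (R : realType) (f : bipoly R) : Prop :=
  (0 < totdeg f)%N /\
  forall g h : bipoly R, f = g * h -> totdeg g = 0%N \/ totdeg h = 0%N.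

Definition zariski_closure (R : realType) (C : set (R * R)) : set (R * R) :=
  [set z | forall g : bipoly R, (forall w, C w -> bieval g w = 0) -> bieval g z = 0].

Definition defining_poly (R : realType) (C : set (R * R)) (f : bipoly R) : Prop :=
  irreducible_bipoly f /\ [set z | bieval f z = 0] = zariski_closure C.

(* the trigonometric polynomial
   p(t) = alpha/2 + sum_{k=0}^N (a_{2k+1} cos((2k+1)t) + b_{2k+1} sin((2k+1)t)),
   with a k standing for a_{2k+1} and b k for b_{2k+1}. *)
Definition trigp (R : realType) (alpha : R) (N : nat) (a b : nat -> R) (t : R) : R :=
  alpha / 2 + \sum_(0 <= k < N.+1)
     (a k * cos ((2 * k + 1)%:R * t) + b k * sin ((2 * k + 1)%:R * t)).

Definition support_curve (R : realType) (p : R -> R) : set (R * R) :=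
  [set z | exists2 t, `[- pi, pi]%classic t &
     z = (p t * cos t - derive1 p t * sin t, p t * sin t + derive1 p t * cos t)].

Definition is_circle (R : realType) (C : set (R * R)) : Prop :=
  exists (c : R * R) (r : R), 0 < r /\
    C = [set z | (z.1 - c.1) ^+ 2 + (z.2 - c.2) ^+ 2 = r ^+ 2].

(* Main.v *)
Require Import Defs.
From HB Require Import structures.
From mathcomp Require Import all_boot all_order all_algebra all_field.
From mathcomp Require Import all_classical all_reals all_analysis.
From mathcomp Require mpoly.
Import (canonicals) mpoly.
From mathcomp Require Import complex ring lra zify.
Set Implicit Arguments. Unset Strict Implicit. Unset Printing Implicit Defensive.
Import Order.TTheory GRing.Theory Num.Theory.
Local Open Scope ring_scope.

(** With u = e^(it), the point z = x + iy of the curve is (p + ip')u, so any two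
    independent real linear forms X, Y in x, y are Laurent polynomials in u with
    poles of exact order 2N+2 at 0 and at infinity (when N > 0; for N = 0 the curve
    is a circle).  Put n = 4N+4, and let F(X, Y) be f in these coordinates.

    Upper bound: a dimension count gives a nonzero G vanishing on the curve with
    deg_Y G <= n, and by Gauss' lemma F has minimal Y-degree among such G.

    Lower bound: for generic complex x0 the equation X(u) = x0 has n simple roots.
    The values Y(u) at these roots are distinct zeros of F(x0, -): since
    dz/du = -u^2 dw/du with w = x - iy, the gradient of F at the point determines u^2, and
    the term alpha u / 2, the only odd one in z, separates u from -u.

    Hence deg_Y F = n in all linear coordinates; the identity, the swap of x and y
    and a generic shear give deg_y, deg_x and the total degree. *)

(** * Gauss' lemma *)

Section GaussLemma.
Variables (K : fieldType) (L : closedFieldType) (iota : {rmorphism K -> L}).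
Local Notation eval_at r := (horner_eval (r : L) \o map_poly iota).

(** [p] is a minimal polynomial of [r] over K: any polynomial vanishing at [r] leaves remainder 0 on
    division by it. Evaluation at [r] thus tests divisibility by [p], which replaces the choice of
    an irreducible factor of [c]. *)
Lemma minpoly_root (c : {poly K}) : (1 < size c)%N ->
  exists (r : L) (p : {poly K}),
    [/\ root (map_poly iota c) r, (1 < size p)%N &
        forall q, root (map_poly iota q) r -> p %| q].
Proof.
move=> c_gt1.
have [r cr0] : exists r, root (map_poly iota c) r.
  by apply/closed_rootP; rewrite size_map_poly; case: (size c) c_gt1 => [|[]].
pose P n := `[< exists2 p : {poly K}, size p = n & (p != 0) && root (map_poly iota p) r >].
have exP : exists n, P n.
  exists (size c); apply/asboolP; exists c => //.
  by rewrite cr0 -size_poly_gt0 (ltn_trans _ c_gt1).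
have [n /asboolP[p sz_p /andP[p_neq0 pr0]] minP] := ex_minnP exP.
have dvd q : root (map_poly iota q) r -> p %| q.
  move=> qr0; apply/modp_eq0P/eqP/negPn/negP => mod_neq0.
  have : P (size (q %% p)).
    apply/asboolP; exists (q %% p) => //; rewrite mod_neq0 /=.
    have /(congr1 (fun q => (map_poly iota q).[r])) := divp_eq q p.
    by rewrite rmorphD rmorphM /= hornerD hornerM (rootP qr0) (rootP pr0) mulr0
               add0r => /esym/rootP.
  by move/minP; rewrite -sz_p leqNgt ltn_modp p_neq0.
exists r, p; split=> //; rewrite ltnNge; apply/negP => /size1_polyC pC.
move: pr0 p_neq0; rewrite pC map_polyC /root hornerC fmorph_eq0 polyC_eq0.
by move=> ->.
Qed.

(** Induction on the degree of [c]. Evaluating the coefficients at a root [r] of [c] sends [Q * G]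
    to 0; as L[Y] is a domain, the minimal polynomial of [r] divides all coefficients of [Q] or all
    those of [G], and is cancelled there without changing the degree in Y. *)
Lemma scale_factor_cancel (c : {poly K}) (F Q G : {poly {poly K}}) :
    c != 0 -> c *: F = Q * G ->
  exists Q' G', [/\ F = Q' * G', size Q' = size Q & size G' = size G].
Proof.
have [n] := ubnP (size c); elim: n => // n IHn in c Q G *.
rewrite ltnS => le_c c_neq0 eqF.
have [c_le1|c_gt1] := leqP (size c) 1.
  have [k cE] : exists k, c = k%:P by exists c`_0; apply: size1_polyC.
  have k_neq0 : k != 0 by rewrite -polyC_eq0 -cE.
  exists ((k^-1)%:P *: Q), G; split=> //; last first.
    by rewrite size_scale // polyC_eq0 invr_eq0.
  by rewrite -scalerAl -eqF scalerA cE -polyCM mulVf // scale1r.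
have [r [p [cr0 p_gt1 p_dvd]]] := minpoly_root c_gt1.
have p_neq0 : p != 0 by rewrite -size_poly_gt0 ltnW.
have pC_neq0 : p%:P != 0 :> {poly {poly K}} by rewrite polyC_eq0.
have scaleE (H : {poly {poly K}}) : map_poly (eval_at r) H = 0 ->
    H = p *: map_poly (fun a => a %/ p) H.
  move=> H0; apply/polyP => i; rewrite coefZ coef_map_id0 ?div0p // mulrC divpK //.
  apply: p_dvd; apply/rootP.
  by have /(congr1 (fun q : {poly L} => q`_i)) := H0; rewrite coef_map coef0.
have [c' cE] := dvdpP _ _ (p_dvd _ cr0).
have c'_neq0 : c' != 0 by apply: contraNneq c_neq0 => c0; rewrite cE c0 mul0r.
have lt_c' : (size c' < n)%N.
  apply: leq_trans le_c; rewrite cE size_mul //.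
  by case: (size p) p_gt1 => [|[|m]] // _; rewrite addnS /= addnS ltnS leq_addr.
have /eqP : map_poly (eval_at r) Q * map_poly (eval_at r) G = 0.
  rewrite -rmorphM -eqF; apply/polyP => i.
  by rewrite coef_map coefZ coef0 /= /horner_eval rmorphM hornerM (rootP cr0) mul0r.
rewrite mulf_eq0 => /orP[] /eqP /scaleE HE.
  have eqF' : c' *: F = map_poly (fun a => a %/ p) Q * G.
    apply: (mulfI pC_neq0); rewrite !mul_polyC scalerA [p * _]mulrC -cE eqF {1}HE.
    by rewrite scalerAl.
  have [Q' [G' [-> sQ sG]]] := IHn _ _ _ lt_c' c'_neq0 eqF'.
  by exists Q', G'; split=> //; rewrite ?sQ ?sG [in RHS]HE size_scale.
have eqF' : c' *: F = Q * map_poly (fun a => a %/ p) G.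
  apply: (mulfI pC_neq0); rewrite !mul_polyC scalerA [p * _]mulrC -cE eqF {1}HE.
  by rewrite scalerAr.
have [Q' [G' [-> sQ sG]]] := IHn _ _ _ lt_c' c'_neq0 eqF'.
by exists Q', G'; split=> //; rewrite ?sQ ?sG [in RHS]HE size_scale.
Qed.

End GaussLemma.

(** * Laurent polynomials and bivariate evaluation *)

Section Laurent.
Variable C : fieldType.
Implicit Types f g : C -> C.

(** Away from 0, [g] is a Laurent polynomial with exponents in [-d, d]; its value at 0 is left
    free. *)
Definition laurent (d : nat) g := exists2 P : {poly C},
  (size P <= d.*2.+1)%N & forall u, u != 0 -> u ^+ d * g u = P.[u].

Lemma laurent_cst c : laurent 0 (fun=> c).
Proof.
exists c%:P => [|u _]; last by rewrite hornerC mul1r.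
by rewrite size_polyC; case: (c != 0).
Qed.

Lemma laurent_widen d e g : (d <= e)%N -> laurent d g -> laurent e g.
Proof.
move=> le_de [P szP PE]; exists ('X^(e - d) * P) => [|u u_neq0].
  apply: leq_trans (size_polyMleq _ _) _; rewrite size_polyXn; lia.
by rewrite hornerM hornerXn -PE // mulrA -exprD subnK.
Qed.

Lemma laurentD d f g : laurent d f -> laurent d g -> laurent d (fun u => f u + g u).
Proof.
move=> [P szP PE] [Q szQ QE]; exists (P + Q) => [|u u_neq0].
  by apply: leq_trans (size_polyD _ _) _; rewrite geq_max szP.
by rewrite mulrDr hornerD PE ?QE.
Qed.

Lemma laurentM d e f g :
  laurent d f -> laurent e g -> laurent (d + e) (fun u => f u * g u).
Proof.
move=> [P szP PE] [Q szQ QE]; exists (P * Q) => [|u u_neq0].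
  by apply: leq_trans (size_polyMleq _ _) _; lia.
by rewrite hornerM exprD mulrACA PE ?QE.
Qed.

Lemma laurentZ d c g : laurent d g -> laurent d (fun u => c * g u).
Proof. by move=> /(laurentM (laurent_cst c)). Qed.

Lemma laurentX d g n : laurent d g -> laurent (d * n) (fun u => g u ^+ n).
Proof.
move=> dg; elim: n => [|n IHn]; first by rewrite muln0; apply: laurent_cst.
rewrite mulnS; have [P szP PE] := laurentM dg IHn.
by exists P => // u /PE <-; rewrite exprS.
Qed.

Lemma laurent_sum d n (g : nat -> C -> C) :
    (forall i, (i < n)%N -> laurent d (g i)) ->
  laurent d (fun u => \sum_(i < n) g i u).
Proof.
elim: n => [|n IHn] gP.
  by exists 0 => [|u _]; rewrite ?size_poly0 // big_ord0 mulr0 horner0.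
have [P szP PE] := laurentD (IHn (fun i lt => gP i (ltnW lt))) (gP n (ltnSn n)).
by exists P => // u /PE <-; rewrite big_ord_recr.
Qed.

Lemma laurent_id : laurent 1 id.
Proof. by exists 'X^2 => [|u _]; rewrite ?size_polyXn // hornerXn. Qed.

Lemma laurent_inv : laurent 1 (fun u => u^-1).
Proof.
by exists 1 => [|u u_neq0]; rewrite ?size_poly1 // hornerC expr1 divff.
Qed.

Lemma laurent_eq0 d g (s : seq C) :
    laurent d g -> uniq s -> (d.*2 < size s)%N ->
    {in s, forall u, u != 0 /\ g u = 0} ->
  forall u, u != 0 -> g u = 0.
Proof.
move=> [P szP PE] s_uniq lt_s sP u u_neq0; apply: (mulfI (expf_neq0 d u_neq0)).
rewrite mulr0 PE // (@roots_geq_poly_eq0 _ P s) ?horner0 //.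
  by apply/allP => v /sP[v_neq0 gv0]; rewrite /root -PE // gv0 mulr0.
exact: leq_trans lt_s.
Qed.

(** A form suited to genericity arguments: the points to avoid are roots of a single nonzero
    polynomial. *)
Lemma laurent_zeros d g v : laurent d g -> v != 0 -> g v != 0 ->
  exists2 P : {poly C}, P != 0 & forall u, u != 0 -> g u = 0 -> root P u.
Proof.
move=> [P _ PE] v_neq0 gv_neq0; exists P => [|u u_neq0 gu0].
  apply: contraNneq gv_neq0 => P0; have := PE _ v_neq0.
  rewrite P0 horner0 => /eqP; rewrite mulf_eq0 expf_eq0 (negPf v_neq0) andbF.
  by [].
by rewrite /root -PE // gu0 mulr0.
Qed.

(** The inner variable is x and the outer one y, so [size F] measures the degree in y. *)
Definition ev2 (F : {poly {poly C}}) (x y : C) : C := F.[y%:P].[x].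

Lemma ev2E A B (F : {poly {poly C}}) x y :
    (size F <= B)%N -> (forall j, (size (F`_j)%R <= A)%N) ->
  ev2 F x y = \sum_(j < B) \sum_(i < A) F`_j`_i * x ^+ i * y ^+ j.
Proof.
move=> szF szFj; rewrite /ev2 (horner_coef_wide _ szF) horner_sum.
apply: eq_bigr => j _; rewrite hornerM -rmorphXn hornerC.
by rewrite (horner_coef_wide _ (szFj j)) mulr_suml.
Qed.

(** A monomial x^i y^j has poles of order at most h (i + j). *)
Lemma laurent_ev2 A B h (F : {poly {poly C}}) X Y :
    (size F <= B.+1)%N -> (forall j, (size (F`_j)%R <= A.+1)%N) ->
    laurent h X -> laurent h Y ->
  laurent (h * (A + B)) (fun u => ev2 F (X u) (Y u)).
Proof.
move=> szF szFj lX lY.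
have [] : laurent (h * (A + B))
    (fun u => \sum_(j < B.+1) \sum_(i < A.+1) F`_j`_i * X u ^+ i * Y u ^+ j).
  pose g j i u := F`_j`_i * X u ^+ i * Y u ^+ j.
  apply: (@laurent_sum _ _ (fun j u => \sum_(i < A.+1) g j i u)) => j ltj.
  apply: laurent_sum => i lti.
  have : laurent (0 + h * i + h * j) (g j i).
    by apply: laurentM (laurentX _ lY); apply: laurentM (laurentX _ lX);
      apply: laurent_cst.
  by apply: laurent_widen; rewrite add0n -mulnDr leq_mul2l leq_add ?orbT.
by move=> P szP PE; exists P => // u /PE <-; rewrite (@ev2E A.+1 B.+1).
Qed.

Lemma laurent_ev2_ex h (F : {poly {poly C}}) X Y : laurent h X -> laurent h Y ->
  exists d, laurent d (fun u => ev2 F (X u) (Y u)).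
Proof.
move=> lX lY; pose A := \max_(j < size F) size (F`_j)%R.
exists (h * (A + size F)); apply: laurent_ev2 lX lY => // j.
have [ltj|gej] := ltnP j (size F); last by rewrite nth_default ?size_poly0.
by apply: leqW; apply: (@leq_bigmax _ (fun j : 'I_(size F) => size (F`_j)%R) (Ordinal ltj)).
Qed.

End Laurent.

(** Laurent polynomials form a domain: were neither factor zero, a nonzero point off the finitely
    many zeros of both would contradict the vanishing of the product. *)
Lemma laurentM_eq0 (L : closedFieldType) d e (f g : L -> L) v :
    laurent d f -> laurent e g -> (forall u, u != 0 -> f u * g u = 0) ->
    v != 0 -> f v != 0 ->
  forall u, u != 0 -> g u = 0.
Proof.
move=> lf lg fg0 v_neq0 fv u u_neq0; apply/eqP/negPn/negP => gu.
have [P P_neq0 PP] := laurent_zeros lf v_neq0 fv.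
have [Q Q_neq0 QP] := laurent_zeros lg u_neq0 gu.
have /closed_nonrootP[w] : 'X * (P * Q) != 0 by rewrite !mulf_neq0 ?polyX_eq0.
rewrite !rootM rootX !negb_or => /and3P[w_neq0 /negP Pw /negP Qw].
have /eqP := fg0 w w_neq0; rewrite mulf_eq0 => /orP[]/eqP.
  by move/(PP _ w_neq0).
by move/(QP _ w_neq0).
Qed.

(** * Degree of a rational plane curve *)

Section RationalCurve.
Variables (K : numFieldType) (L : closedFieldType) (phi : {rmorphism K -> L}).
Variables (h : nat) (P : {poly L}) (X Y : L -> L).
Variables (pt : nat -> L) (xr yr : nat -> K).
(** [szP] and [P0] say that X has poles of exact order h at infinity and at 0. The parameters [pt k]
    give K-rational points of the curve, at which polynomials over K are tested. *)
Hypotheses (h_gt0 : (0 < h)%N) (szP : size P = h.*2.+1) (P0 : P.[0] != 0).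
Hypothesis XE : forall u : L, u != 0 -> u ^+ h * X u = P.[u].
Hypothesis lY : laurent h Y.
Hypotheses (pt_inj : injective pt) (pt_neq0 : forall k, pt k != 0).
Hypotheses (ptX : forall k, X (pt k) = phi (xr k)) (ptY : forall k, Y (pt k) = phi (yr k)).
Implicit Types (F G H : {poly {poly K}}) (u v : L).

Local Notation lift := (map_poly (map_poly phi)).
Let vanish F := forall u, u != 0 -> ev2 (lift F) (X u) (Y u) = 0.

Lemma laurent_abscissa : laurent h X.
Proof. by exists P => //; rewrite szP. Qed.

Lemma ev2_lift F x y : ev2 (lift F) (phi x) (phi y) = phi (ev2 F x y).
Proof. by rewrite /ev2 -horner_map /= -horner_map /= map_polyC. Qed.

Lemma vanish_pts d F : laurent d (fun u => ev2 (lift F) (X u) (Y u)) ->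
  (forall k, (k <= d.*2)%N -> ev2 F (xr k) (yr k) = 0) -> vanish F.
Proof.
move=> lF F0; apply: (@laurent_eq0 _ d _ [seq pt k | k <- iota 0 d.*2.+1]) => //.
- by rewrite map_inj_uniq // iota_uniq.
- by rewrite size_map size_iota.
move=> _ /mapP[k k_in ->]; split=> //.
rewrite ptX ptY ev2_lift F0 ?rmorph0 //.
by rewrite mem_iota in k_in.
Qed.

Lemma vanish_real F : (forall k, ev2 F (xr k) (yr k) = 0) -> vanish F.
Proof.
move=> F0; have [d lF] := laurent_ev2_ex (lift F) laurent_abscissa lY.
exact: vanish_pts lF _.
Qed.

Lemma level_poly_root x0 u : root (P - x0 *: 'X^h) u -> u != 0 /\ X u = x0.
Proof.
rewrite /root !hornerE => /eqP Pu; have u_neq0 : u != 0.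
  apply: contra_eq_neq Pu => ->; rewrite expr0n eqn0Ngt h_gt0 mulr0 subr0.
  exact: P0.
split=> //; apply: (mulfI (expf_neq0 h u_neq0)).
by rewrite XE //; apply/eqP; rewrite mulrC -subr_eq0; apply/eqP.
Qed.

Lemma size_level_poly x0 : size (P - x0 *: 'X^h) = h.*2.+1.
Proof.
rewrite size_polyDl szP // size_polyN; apply: leq_ltn_trans (size_scale_leq _ _) _.
by rewrite size_polyXn; lia.
Qed.

Lemma abscissa_surj x0 : exists2 u, u != 0 & X u = x0.
Proof.
have /closed_rootP[u] : size (P - x0 *: 'X^h) != 1 by rewrite size_level_poly; lia.
by move=> /level_poly_root[u_neq0 Xu]; exists u.
Qed.

(** [X] takes every value in L, so a nonzero polynomial in x alone cannot vanish on the curve. *)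
Lemma vanish_size_gt1 G : G != 0 -> vanish G -> (1 < size G)%N.
Proof.
move=> G_neq0 G0; rewrite ltnNge; apply/negP => /size1_polyC GE.
have c_neq0 : map_poly phi G`_0 != 0.
  by rewrite map_poly_eq0; apply: contraNneq G_neq0 => c0; rewrite GE c0.
have /closed_nonrootP[x0] := c_neq0; have [u u_neq0 <-] := abscissa_surj x0.
have := G0 u u_neq0; rewrite {1}GE /ev2 map_polyC hornerC => cu0 /negP; apply.
exact/rootP.
Qed.

Lemma vanish_modp F G : vanish F -> vanish G -> vanish (F %% G).
Proof.
move=> F0 G0 u u_neq0; have := Pdiv.Idomain.divp_eq F G.
move=> /(congr1 (fun H => ev2 (lift H) (X u) (Y u))).
rewrite -mul_polyC rmorphM rmorphD rmorphM /ev2 /= !(hornerD, hornerM).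
move: (F0 u u_neq0) (G0 u u_neq0); rewrite /ev2 => -> ->.
by rewrite !mulr0 add0r.
Qed.

(** * Degree of an irreducible equation of the curve *)

Section Irreducible.
Variable F : {poly {poly K}}.
Hypotheses (F_neq0 : F != 0) (F0 : vanish F).
Hypothesis F_irr : forall G H, F = G * H -> (size G <= 1)%N \/ (size H <= 1)%N.

(* A nonzero vanishing polynomial of minimal degree pseudo-divides F, and
   Gauss' lemma turns this into an honest factorization of F. *)
Lemma vanish_size_min G : G != 0 -> vanish G -> (size F <= size G)%N.
Proof.
move=> G_neq0 G0.
pose Q n := `[< exists2 H : {poly {poly K}}, size H = n & H != 0 /\ vanish H >].
have exQ : exists n, Q n by exists (size G); apply/asboolP; exists G.
have [n /asboolP[G1 szG1 [G1_neq0 G10]] minQ] := ex_minnP exQ.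
have le_n : (n <= size G)%N by apply: minQ; apply/asboolP; exists G.
have mod0 : F %% G1 = 0.
  apply/eqP/negPn/negP => mod_neq0.
  have /minQ : Q (size (F %% G1)).
    by apply/asboolP; exists (F %% G1) => //; split=> //; apply: vanish_modp.
  by rewrite -szG1 leqNgt Pdiv.Idomain.ltn_modp G1_neq0.
have := Pdiv.Idomain.divp_eq F G1; rewrite mod0 addr0.
move=> /(scale_factor_cancel phi)[|Q' [G' [FE szQ' szG']]].
  by rewrite expf_neq0 // lead_coef_eq0.
have szG'_gt1 : (1 < size G')%N by rewrite szG' vanish_size_gt1.
have Q'_neq0 : Q' != 0 by apply: contraNneq F_neq0 => Q0; rewrite FE Q0 mul0r.
have G'_neq0 : G' != 0 by rewrite -size_poly_gt0 ltnW.
(* [G'] has positive degree in Y, so [Q'] has degree 0 in Y and F has the same Y-degree as [G1]. *)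
case: (F_irr FE) => [Q'_le1|]; last by rewrite leqNgt szG'_gt1.
apply: leq_trans le_n; rewrite -szG1 -szG' FE size_mul //.
by rewrite -subn1 leq_subLR leq_add2r.
Qed.

(** Dimension count: the coefficients of [G] are the unknowns, and the bound on the Laurent order
    makes vanishing at finitely many sample points enough. *)
Lemma ex_vanish_size_le : exists G, [/\ G != 0, vanish G & (size G <= h.*2.+1)%N].
Proof.
(* With A = n^2 there are (A+1)(n+1) = n^3+n^2+n+1 coefficients against m = n(A+n)+1 = n^3+n^2+1
   conditions, so [M], with monomials as rows and sample points as columns, has a nonzero left
   kernel vector. *)
pose n := h.*2; pose A := (n * n)%N; pose m := (h * (A + n)).*2.+1.
pose M : 'M[K]_(A.+1 * n.+1, m) := \matrix_(r, k)
  mxvec (\matrix_(i < A.+1, j < n.+1) (xr k ^+ i * yr k ^+ j)) 0 r.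
have : kermx M != 0.
  rewrite kermx_eq0 -row_leq_rank -ltnNge; apply: leq_ltn_trans (rank_leq_col M) _.
  by rewrite /m /A /n; nia.
case/rowV0Pn => v /sub_kermxP vM v_neq0; pose V := vec_mx v.
pose G : {poly {poly K}} :=
  \poly_(j < n.+1) \poly_(i < A.+1) V (inord i) (inord j).
have szG : (size G <= n.+1)%N by apply: size_poly.
have szGj j : (size (G`_j)%R <= A.+1)%N.
  by rewrite coef_poly; case: ifP => _; rewrite ?size_poly0 ?size_poly.
have GE (i : 'I_A.+1) (j : 'I_n.+1) : G`_j`_i = V i j.
  by rewrite !coef_poly ltn_ord coef_poly ltn_ord !inord_val.
exists G; split=> //.
  apply: contraNneq v_neq0 => G0; rewrite -[v]vec_mxK -/V.
  suff -> : V = 0 by rewrite linear0.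
  by apply/matrixP => i j; rewrite -GE G0 !coef0 mxE.
have lG : laurent (h * (A + n)) (fun u => ev2 (lift G) (X u) (Y u)).
  apply: laurent_ev2 laurent_abscissa lY => [|j].
    by apply: leq_trans (size_poly _ _) _.
  by rewrite coef_map size_map_poly.
apply: vanish_pts lG _ => k lek.
have /matrixP/(_ 0 (Ordinal (lek : (k < m)%N))) := vM.
rewrite !mxE => vk; rewrite (@ev2E _ A.+1 n.+1) // -[RHS]vk.
rewrite (reindex _ (curry_mxvec_bij _ _)) /= exchange_big pair_bigA /=.
apply: eq_bigr => -[i j] _ /=; rewrite !mxE mxvecE mxE GE /V mxE mulrA.
by [].
Qed.

Lemma vanish_size_le : (size F <= h.*2.+1)%N.
Proof.
have [G [G_neq0 G0 szG]] := ex_vanish_size_le.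
exact: leq_trans (vanish_size_min G_neq0 G0) szG.
Qed.

(** In characteristic 0 the derivative in Y is nonzero and of lower degree; if it vanished on the
    curve, the minimality of F would fail. *)
Lemma deriv_not_vanish :
  exists2 v, v != 0 & ev2 (lift F^`()) (X v) (Y v) != 0.
Proof.
apply: contrapT => noex; have F_gt1 := vanish_size_gt1 F_neq0 F0.
have dF_neq0 : F^`() != 0.
  rewrite -size_poly_eq0 (@size_poly_eq _ _ (fun i => F`_i.+1 *+ i.+1)).
    by rewrite -lt0n ltn_predRL.
  rewrite prednK ?ltn_predRL // -/(lead_coef F).
  by rewrite -mulr_natr mulf_neq0 ?lead_coef_eq0 // -polyC_natr polyC_eq0 pnatr_eq0;
    case: (size F) F_gt1 => [|[]].
have := lt_size_deriv F_neq0; rewrite ltnNge => /negP; apply.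
apply: vanish_size_min => // u u_neq0; apply/eqP/negPn/negP => Fu.
by apply: noex; exists u.
Qed.

(** Injectivity is asked only off the zeros of the derivative in Y, which a generic abscissa
    avoids. *)
Hypothesis param_inj : forall u v, u != 0 -> v != 0 -> X u = X v -> Y u = Y v ->
  ev2 (lift F^`()) (X u) (Y u) != 0 -> u = v.

(* Over a generic abscissa x0 the 2h solutions u of X u = x0 are distinct, and so
   are the values Y u, which are roots of F (x0, -). *)
Lemma vanish_size_ge : (h.*2 < size F)%N.
Proof.
have [v v_neq0 Fv] := deriv_not_vanish.
have [d ldF] := laurent_ev2_ex (lift F^`()) laurent_abscissa lY.
have [P1 P1_neq0 P1P] := laurent_zeros ldF v_neq0 Fv.
have phi_nat_neq0 n : (0 < n)%N -> n%:R != 0 :> L.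
  by move=> n_gt0; rewrite -(rmorph_nat phi) fmorph_eq0 pnatr_eq0 -lt0n.
(* Since X = P / u^h, [B] is u^(h+1) X'(u): its nonzero roots are the critical points of X. Its
   coefficient of degree 2h is (2h - h) times that of [P]. *)
pose B := 'X * P^`() - h%:R *: P.
have B_neq0 : B != 0.
  apply/eqP => /(congr1 (fun q : {poly L} => q`_(h.*2))) /eqP; apply/negP.
  rewrite coef0 coefB coefZ coefXM double_eq0 eqn0Ngt h_gt0 /=.
  have -> : h.*2 = h.*2.-1.+1 by lia.
  rewrite coef_deriv /= -[X in X - _]mulr_natl -mulrBl mulf_neq0 //.
    have -> : h.*2.-1.+1 = (h + h)%N by lia.
    by rewrite natrD addrK phi_nat_neq0.
  have -> : h.*2.-1.+1 = (size P).-1 by rewrite szP; lia.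
  by rewrite -/(lead_coef P) lead_coef_eq0 -size_poly_gt0 szP.
(* [x0] is chosen off the values of X at the roots of [P1 * B]. *)
have [r rE] := closed_field_poly_normal (P1 * B).
have /closed_nonrootP[x0] : \prod_(z <- [seq X z | z <- r]) ('X - z%:P) != 0.
  by apply: monic_neq0; apply: monic_prod_XsubC.
rewrite root_prod_XsubC => x0_notin.
have generic u : u != 0 -> X u = x0 -> ~~ root P1 u /\ ~~ root B u.
  move=> u_neq0 Xu; apply/andP; rewrite -negb_or -rootM rE rootZ; last first.
    by rewrite lead_coef_eq0 mulf_neq0.
  by rewrite root_prod_XsubC; apply: contra x0_notin => ur; rewrite -Xu map_f.
pose Q := P - x0 *: 'X^h; have szQ : size Q = h.*2.+1 by apply: size_level_poly.
have Q_neq0 : Q != 0 by rewrite -size_poly_gt0 szQ.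
(* At a common root of [Q] and its derivative, P' = x0 h u^(h-1) and P = x0 u^h, so [B] vanishes
   there, against the choice of [x0]. *)
have Q_sep : separable_poly Q.
  rewrite unlock; apply/Pdiv.ClosedField.coprimepP => u Qu.
  have [u_neq0 Xu] := level_poly_root Qu; have [_ ] := generic u u_neq0 Xu.
  apply: contra => /eqP dQu; rewrite /root.
  have : P^`().[u] = x0 * (u ^+ h.-1 *+ h).
    apply/eqP; rewrite -subr_eq0; move: dQu.
    by rewrite /Q derivB derivZ derivXn !hornerE hornerMn hornerXn => ->.
  rewrite !hornerE => ->; rewrite -XE // Xu.
  case: (h) h_gt0 => // k _ /=; rewrite exprS -mulr_natl.
  by apply/eqP; ring.
have [s sE] := closed_field_poly_normal Q.
have s_uniq : uniq s.
  rewrite -separable_prod_XsubC; have := Q_sep; rewrite {1}sE.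
  by rewrite (eqp_separable (eqp_scale _ _)) // lead_coef_eq0.
have s_root u : u \in s -> u != 0 /\ X u = x0.
  move=> us; apply: level_poly_root; rewrite -/Q sE rootZ ?lead_coef_eq0 //.
  by rewrite root_prod_XsubC.
have sz_s : size s = h.*2.
  have := szQ; rewrite {1}sE size_scale ?lead_coef_eq0 //.
  by rewrite size_prod_XsubC => -[].
have FdY u : u \in s -> ev2 (lift F^`()) (X u) (Y u) != 0.
  move=> /s_root[u_neq0 Xu]; have [+ _] := generic u u_neq0 Xu.
  by apply: contra => /eqP /(P1P _ u_neq0).
(* [F1] is F(x0, Y); it is nonzero because its derivative does not vanish at [Y u] for [u] in
   [s]. *)
pose F1 := map_poly (horner_eval x0) (lift F).
have F1E (G : {poly {poly K}}) y :
    (map_poly (horner_eval x0) (lift G)).[y] = ev2 (lift G) x0 y.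
  by rewrite /ev2 -{1}[y](hornerC y x0) [LHS]horner_map.
have F1_neq0 : F1 != 0.
  have [u us] : exists u, u \in s.
    case: (s) sz_s => [/= h0|u ? _]; last by exists u; rewrite mem_head.
    by move: h_gt0; rewrite -double_gt0 -h0.
  have [u_neq0 Xu] := s_root u us.
  apply: contraNneq (FdY u us) => F10; rewrite Xu -F1E -!deriv_map -/F1 F10.
  by rewrite deriv0 horner0.
apply: (@leq_trans (size F1)); last first.
  by apply: leq_trans (size_poly _ _) _; apply: size_poly.
rewrite -sz_s -(size_map Y); apply: max_poly_roots => //.
  apply/allP => _ /mapP[u us ->]; have [u_neq0 Xu] := s_root u us.
  by rewrite /root F1E -Xu F0.
rewrite map_inj_in_uniq // => u w us ws Yuw.
have [u_neq0 Xu] := s_root u us; have [w_neq0 Xw] := s_root w ws.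
by apply: param_inj; rewrite ?Xw //; apply: FdY.
Qed.

Lemma vanish_size_eq : size F = h.*2.+1.
Proof. by apply/eqP; rewrite eqn_leq vanish_size_le vanish_size_ge. Qed.

End Irreducible.
End RationalCurve.

(** * Linear changes of coordinates in R[x,y] *)

Section LinearSubstitution.
Variable R : realType.
Implicit Types (f : bipoly R) (F G H : {poly {poly R}}).

Definition pairfun (T : Type) (x y : T) (i : 'I_2) : T :=
  if val i == 0%N then x else y.

Lemma pairfun_comp (S T : Type) (g : S -> T) x y i :
  g (pairfun x y i) = pairfun (g x) (g y) i.
Proof. by rewrite /pairfun; case: ifP. Qed.

Lemma rmorph_mmap (S T : comNzRingType) (c : R -> S) (h : 'I_2 -> S)
    (g : {rmorphism S -> T}) f :
  g (mpoly.mmap c h f) = mpoly.mmap (g \o c) (g \o h) f.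
Proof.
rewrite /mpoly.mmap rmorph_sum; apply: eq_bigr => m _.
rewrite rmorphM /mpoly.mmap1 rmorph_prod; congr (_ * _).
by apply: eq_bigr => i _; rewrite rmorphXn.
Qed.

Lemma eq_mmap (S : comNzRingType) (c c' : R -> S) (h h' : 'I_2 -> S) f :
  c =1 c' -> h =1 h' -> mpoly.mmap c h f = mpoly.mmap c' h' f.
Proof.
by move=> eqc eqh; apply: eq_bigr => m _; rewrite eqc (mpoly.mmap1_eq _ eqh).
Qed.

(** The existence half of the universal property of R[X][Y]; [poly2_rmorph_id] is an instance of
    uniqueness. *)
Lemma poly2_rmorph_exists (S : comNzRingType) (k : {rmorphism R -> S}) (s t : S) :
  exists g : {rmorphism {poly {poly R}} -> S},
    [/\ forall e, g e%:P%:P = k e, g 'X%:P = s & g 'X = t].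
Proof.
pose g1 : {rmorphism {poly R} -> S} := horner_eval s \o map_poly k.
pose g : {rmorphism {poly {poly R}} -> S} := horner_eval t \o map_poly g1.
have gC c : g c%:P = g1 c by rewrite -[RHS](hornerC _ t) -(map_polyC g1).
have g1E c : g1 c = (map_poly k c).[s] by [].
exists g; split=> [e||].
- by rewrite gC g1E map_polyC hornerC.
- by rewrite gC g1E map_polyX hornerX.
by rewrite -[RHS]hornerX -(map_polyX g1).
Qed.

Lemma poly2_rmorph_id (g : {rmorphism {poly {poly R}} -> {poly {poly R}}}) :
    (forall e : R, g e%:P%:P = e%:P%:P) -> g 'X%:P = 'X%:P -> g 'X = 'X ->
  g =1 id.
Proof.
move=> gC gX gY G; rewrite -[G in LHS]coefK poly_def rmorph_sum /= -[RHS]coefK poly_def.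
apply: eq_bigr => j _; rewrite -mul_polyC rmorphM rmorphXn /= gY; congr (_ * _).
rewrite -[G`_j in LHS]coefK poly_def [in LHS]rmorph_sum rmorph_sum /=.
rewrite -[G`_j in RHS]coefK poly_def rmorph_sum /=.
by apply: eq_bigr => i _; rewrite -mul_polyC !rmorphM /= gC !rmorphXn /= gX.
Qed.

(* Rewrites f in coordinates (X, Y), the outer variable being Y, with
   x = a X + b Y and y = c X + d Y. *)
Definition lin_subst (a b c d : R) f : {poly {poly R}} :=
  mpoly.mmap (polyC \o polyC)
    (pairfun ((a *: 'X)%:P + b%:P *: 'X) ((c *: 'X)%:P + d%:P *: 'X)) f.

Lemma ev2_lin_subst a b c d f x y :
  ev2 (lin_subst a b c d f) x y = bieval f (a * x + b * y, c * x + d * y).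
Proof.
pose g : {rmorphism {poly {poly R}} -> R} := horner_eval x \o horner_eval y%:P.
have gE F : ev2 F x y = g F by [].
rewrite gE rmorph_mmap; apply: eq_mmap => [e|i] /=.
  by rewrite /horner_eval !hornerC.
by rewrite /pairfun; case: ifP => _; rewrite /horner_eval !hornerE.
Qed.

(** * Invertible linear substitutions and irreducibility *)

Section Inverse.
Variables (a b c d : R).
Hypothesis det_neq0 : a * d - b * c != 0.
Let D := a * d - b * c.
Let a' := d / D.
Let b' := - b / D.
Let c' := - c / D.
Let d' := a / D.

Let x : bipoly R := mpoly.mpolyX R (mpoly.mnm1 (@ord0 1)).
Let y : bipoly R := mpoly.mpolyX R (mpoly.mnm1 (@ord_max 1)).

(** [psi] sends X and Y to the linear forms of the inverse matrix; both composites fix the constants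
    and the variables. *)
Lemma lin_unsubst_exists : exists psi : {rmorphism {poly {poly R}} -> bipoly R},
  cancel (lin_subst a b c d) psi /\ cancel psi (lin_subst a b c d).
Proof.
have inv11 : a * a' + b * c' = 1 by rewrite /a' /c' /D; field.
have inv12 : a * b' + b * d' = 0 by rewrite /b' /d' /D; field.
have inv21 : c * a' + d * c' = 0 by rewrite /a' /c' /D; field.
have inv22 : c * b' + d * d' = 1 by rewrite /b' /d' /D; field.
have vni11 : a' * a + b' * c = 1 by rewrite /a' /b' /D; field.
have vni12 : a' * b + b' * d = 0 by rewrite /a' /b' /D; field.
have vni21 : c' * a + d' * c = 0 by rewrite /c' /d' /D; field.
have vni22 : c' * b + d' * d = 1 by rewrite /c' /d' /D; field.
have [psi [psiC psiX psiY]] := poly2_rmorph_exists (@mpoly.mpolyC 2 R)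
  (a' *: x + b' *: y) (c' *: x + d' *: y).
exists psi; split=> [f|].
  rewrite rmorph_mmap [RHS]mpoly.mpolyE; apply: eq_bigr => m _.
  rewrite -mpoly.mul_mpolyC -mpoly.mmap1_id; congr (_ * _); first exact: psiC.
  apply: mpoly.mmap1_eq => i /=; rewrite pairfun_comp !rmorphD -!mul_polyC !rmorphM /=.
  have combE e1 e2 : e1 *: (a' *: x + b' *: y) + e2 *: (c' *: x + d' *: y) =
      (e1 * a' + e2 * c') *: x + (e1 * b' + e2 * d') *: y.
    by rewrite !scalerDr !scalerA addrACA -!scalerDl.
  rewrite psiX psiY !psiC !mpoly.mul_mpolyC !combE inv11 inv12 inv21 inv22.
  rewrite !scale0r !scale1r addr0 add0r /pairfun /x /y.
  by case: i => -[|[|//]] lti /=; congr (mpoly.mpolyX _ (mpoly.mnm1 _)); apply: val_inj.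
pose g : {rmorphism bipoly R -> {poly {poly R}}} := mpoly.mmap (polyC \o polyC)
    (pairfun ((a *: 'X)%:P + b%:P *: 'X) ((c *: 'X)%:P + d%:P *: 'X)).
have gZ e f : g (e *: f) = e%:P%:P * g f.
  by rewrite -mpoly.mul_mpolyC rmorphM; congr (_ * _); apply: mpoly.mmapC.
have gx : g x = a%:P%:P * 'X%:P + b%:P%:P * 'X.
  by rewrite [g x]mpoly.mmapX mpoly.mmap1U /= -!mul_polyC polyCM.
have gy : g y = c%:P%:P * 'X%:P + d%:P%:P * 'X.
  by rewrite [g y]mpoly.mmapX mpoly.mmap1U /= -!mul_polyC !polyCM.
have combE e1 e2 : g (e1 *: x + e2 *: y) =
    (e1 * a + e2 * c)%:P%:P * 'X%:P + (e1 * b + e2 * d)%:P%:P * 'X.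
  by rewrite rmorphD !gZ gx gy !polyCD !polyCM; ring.
pose gpsi : {rmorphism {poly {poly R}} -> {poly {poly R}}} := g \o psi.
apply: (@poly2_rmorph_id gpsi).
- by move=> e; rewrite /gpsi /= psiC; apply: mpoly.mmapC.
- rewrite [LHS](congr1 g psiX) combE vni11 vni12.
  by rewrite !polyC0 mul0r addr0 !polyC1 mul1r.
rewrite [LHS](congr1 g psiY) combE vni21 vni22.
by rewrite !polyC0 mul0r add0r !polyC1 mul1r.
Qed.

Lemma totdeg_eq0 f : totdeg f = 0%N -> exists e, f = mpoly.mpolyC 2 e.
Proof.
move=> f_deg; exists (mpoly.mcoeff mpoly.mnm0 f); apply: mpoly.msize1_polyC.
rewrite mpoly.msizeE; apply/bigmax_leqP_seq => m m_supp _; rewrite ltnS.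
by apply: leq_trans (leq_bigmax_seq _ m_supp isT) _; rewrite -/(totdeg f) f_deg.
Qed.

Lemma lin_substC e : lin_subst a b c d (mpoly.mpolyC 2 e) = e%:P%:P.
Proof. exact: mpoly.mmapC. Qed.

Lemma lin_subst_neq0 f : f != 0 -> lin_subst a b c d f != 0.
Proof.
have [psi [substK _]] := lin_unsubst_exists.
by apply: contraNneq => F0; rewrite -[f]substK F0 rmorph0.
Qed.

(** [psi] turns a factorization of the substituted polynomial into one of [f], so one factor is
    constant; only its degree in Y is retained. *)
Lemma lin_subst_irreducible f : irreducible_bipoly f ->
  forall G H, lin_subst a b c d f = G * H -> (size G <= 1)%N \/ (size H <= 1)%N.
Proof.
have [psi [substK psiK]] := lin_unsubst_exists.
have size_const G : totdeg (psi G) = 0%N -> (size G <= 1)%N.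
  move=> /totdeg_eq0[e psiG]; rewrite -[G]psiK psiG lin_substC.
  exact: size_polyC_leq1.
move=> [_ f_irr] G H FE.
have /f_irr[] : f = psi G * psi H by rewrite -rmorphM -FE substK.
  by move/size_const; left.
by move/size_const; right.
Qed.

End Inverse.

(** When only variable [i] has an image involving the outer variable, to degree at most 1, the outer
    degree is at most the partial degree in [i]. The lower bounds on [deg_x] and [deg_y] come from
    this. *)
Lemma size_mmap_le (h : 'I_2 -> {poly {poly R}}) (i : 'I_2) f :
    (forall k, size (h k) <= (k == i).+1)%N ->
  (size (mpoly.mmap (polyC \o polyC) h f) <= (pdeg i f).+1)%N.
Proof.
move=> hP; rewrite /mpoly.mmap big_seq.
elim/big_rec: _ => [|m F m_supp IH]; first by rewrite size_poly0.
apply: leq_trans (size_polyD _ _) _; rewrite geq_max IH andbT.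
apply: (@leq_trans (mpoly.fun_of_multinom m i).+1); last first.
  by rewrite ltnS; apply: (leq_bigmax_seq (F := fun m => mpoly.fun_of_multinom m i)).
rewrite mul_polyC; apply: leq_trans (size_scale_leq _ _) _; rewrite /mpoly.mmap1.
have <- : (\sum_k (k == i) * mpoly.fun_of_multinom m k = mpoly.fun_of_multinom m i)%N.
  by rewrite (bigD1 i) //= eqxx mul1n big1 ?addn0 // => k /negPf->.
elim/big_rec2: _ => [|k z q _ IHq]; first by rewrite size_poly1.
apply: leq_trans (size_polyMleq _ _) _; rewrite -subn1 leq_subLR add1n.
rewrite -addnS -addSn leq_add //; apply: leq_trans (size_poly_exp_leq _ _) _.
by rewrite ltnS leq_mul2r -subn1 leq_subLR add1n hP orbT.
Qed.

Lemma ex_nonroot (Q : {poly R}) : Q != 0 -> exists t, Q.[t] != 0.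
Proof.
move=> Q_neq0; apply: contrapT => noex; move/eqP: Q_neq0; apply.
apply: (@roots_geq_poly_eq0 _ Q [seq k%:R | k <- iota 0 (size Q)]).
- apply/allP => _ /mapP[k _ ->]; apply/negPn/negP => Qk; apply: noex.
  by exists k%:R.
- by rewrite map_inj_uniq ?iota_uniq // => j k /eqP; rewrite eqr_nat => /eqP.
by rewrite size_map size_iota.
Qed.

Lemma mdeg2 (m : mpoly.multinom 2) :
  mpoly.mdeg m = (mpoly.fun_of_multinom m ord0 + mpoly.fun_of_multinom m ord_max)%N.
Proof.
rewrite mpoly.mdegE big_ord_recl big_ord1; congr (_ + mpoly.fun_of_multinom m _)%N.
exact: val_inj.
Qed.

(** Put x = X + tY, y = Y, and let f_e be the homogeneous part of top degree e. The coefficient of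
    Y^e at X = 0 is f_e(t, 1), which is nonzero for some t. *)
Lemma totdeg_lt_size_shear f : f != 0 ->
  exists t, (totdeg f < size (lin_subst 1 t 0 1 f))%N.
Proof.
move=> f_neq0; pose e := totdeg f.
have [m m_supp m_deg] : exists2 m, m \in mpoly.msupp f & mpoly.mdeg m = e.
  have : mpoly.msupp f != [::] by rewrite mpoly.msupp_eq0.
  rewrite /e /totdeg; elim: (mpoly.msupp f) => // m0 [|m1 s] IHs _.
    by exists m0; rewrite ?mem_head // big_seq1.
  have [//|m ms mE] := IHs; rewrite big_cons -mE.
  case: leqP => _; first by exists m; rewrite // in_cons ms orbT.
  by exists m0; rewrite ?mem_head.
(* [Q] is f_e(t, 1) as a polynomial in t. Monomials of degree e differ in their exponent of x, so
   nothing cancels. *)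
pose Q : {poly R} := \sum_(m <- mpoly.msupp f | mpoly.mdeg m == e)
  mpoly.mcoeff m f *: 'X^(mpoly.fun_of_multinom m ord0).
have Q_neq0 : Q != 0.
  apply/eqP => /(congr1 (fun q : {poly R} => q`_(mpoly.fun_of_multinom m ord0))) /eqP.
  apply/negP; rewrite coef0 coef_sum -big_filter.
  rewrite (bigD1_seq m) ?filter_uniq ?mpoly.msupp_uniq ?mem_filter ?m_deg ?eqxx //=.
  rewrite coefZ coefXn eqxx mulr1 big1_seq ?addr0 -?mpoly.mcoeff_msupp //.
  move=> m'; rewrite mem_filter => /andP[m'_neq /andP[/eqP deg_m' _]].
  rewrite coefZ coefXn.
  case: eqP => [eq0|]; last by rewrite mulr0.
  case/eqP: m'_neq; apply/mpoly.mnmP => k.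
  have eq1 : mpoly.fun_of_multinom m' ord_max = mpoly.fun_of_multinom m ord_max.
    by apply: (@addnI (mpoly.fun_of_multinom m ord0)); rewrite -mdeg2 {1}eq0 -mdeg2 m_deg.
  have [->|->] : k = ord0 \/ k = ord_max; last by [].
    by case: k => -[|[|//]] ltk; [left | right]; apply: val_inj.
  by rewrite eq0.
have [t Qt] := ex_nonroot Q_neq0; exists t; rewrite ltnNge; apply: contra Qt => size_le.
have gE : horner_eval 0 ((lin_subst 1 t 0 1 f)`_e) = Q.[t].
  have [g gE] : exists g : {rmorphism {poly {poly R}} -> {poly R}},
      forall F, g F = map_poly (horner_eval 0) F by exists (map_poly (horner_eval 0)).
  have gC (q : {poly R}) : g q%:P = (q.[0])%:P by rewrite gE map_polyC.
  have gX : g 'X = 'X by rewrite gE map_polyX.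
  rewrite -(coef_map (horner_eval 0)) -gE rmorph_mmap coef_sum.
  rewrite [Q in RHS]big_mkcond horner_sum; apply: eq_bigr => m' _.
  have gD (r w : R) : g ((r *: 'X)%:P + w%:P *: 'X) = w *: 'X.
    rewrite rmorphD gC hornerZ hornerX mulr0 polyC0 add0r.
    by rewrite -[w%:P *: 'X]mul_polyC rmorphM gC gX hornerC mul_polyC.
  rewrite /= gC hornerC coefCM /mpoly.mmap1 big_ord_recl big_ord1 /=.
  rewrite /pairfun /= !gD scale1r exprZn -scalerAl -exprD coefZ coefXn.
  rewrite (_ : lift _ _ = ord_max) -?mdeg2; last exact: val_inj.
  rewrite [e == _]eq_sym; case: eqP => _; last by rewrite mulr0 mulr0 horner0.
  by rewrite mulr1 hornerZ hornerXn.
by rewrite -gE nth_default // /horner_eval horner0.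
Qed.
End LinearSubstitution.

(** * The support curve *)

Section Derivatives.
Variable R : realType.
Implicit Types (t m r s : R).

Lemma is_derive_trig_term m r s t :
  is_derive t (1 : R) (fun t => r * cos (m * t) + s * sin (m * t))
    (m * (s * cos (m * t) - r * sin (m * t))).
Proof.
have dm : is_derive t (1 : R) (fun t => m * t) m.
  apply: is_derive_eq (is_deriveZ m (is_derive_id t (1 : R))) _.
  by rewrite /GRing.scale /= mulr1.
have dc := is_derive1_comp (is_derive_cos (m * t)) dm.
have ds := is_derive1_comp (is_derive_sin (m * t)) dm.
have := is_deriveD (is_deriveZ r dc) (is_deriveZ s ds).
move=> H; apply: is_derive_eq H _.
rewrite /GRing.scale /=; ring.
Qed.

Lemma is_derive_sum_nat n (f df : nat -> R -> R) t :
    (forall k, is_derive t (1 : R) (f k) (df k t)) ->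
  is_derive t (1 : R) (fun t => \sum_(0 <= k < n) f k t) (\sum_(0 <= k < n) df k t).
Proof.
move=> fP; elim: n => [|n IHn].
  rewrite big_nil (_ : (fun t => _) = cst 0); first exact: is_derive_cst.
  by apply/funext => s; rewrite big_nil.
rewrite big_nat_recr //= (_ : (fun t => _) = (fun t => \sum_(0 <= k < n) f k t) \+ f n).
  exact: is_deriveD.
by apply/funext => s; rewrite big_nat_recr.
Qed.

(** Chain rule: the partial derivative in x acts on the coefficients of [F], the one in y is the
    outer derivative. *)
Lemma is_derive_ev2 (F : {poly {poly R}}) (x y : R -> R) t dx dy :
    is_derive t (1 : R) x dx -> is_derive t (1 : R) y dy ->
  is_derive t (1 : R) (fun t => ev2 F (x t) (y t))
    (ev2 (map_poly (@deriv R) F) (x t) (y t) * dx + ev2 F^`() (x t) (y t) * dy).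
Proof.
move=> xP yP.
have horner_derive (c : {poly R}) : is_derive t (1 : R) (fun t => c.[x t]) (c^`().[x t] * dx).
  elim/poly_ind: c => [|c e IHc].
    rewrite (_ : (fun t => _) = cst 0); last by apply/funext => s; rewrite horner0.
    by rewrite deriv0 horner0 mul0r; apply: is_derive_cst.
  rewrite (_ : (fun t => _) = (fun t => c.[x t]) * x + cst e); last first.
    by apply/funext => s; rewrite /= !hornerE.
  apply: is_derive_eq (is_deriveD (is_deriveM IHc xP) (is_derive_cst _ _ _)) _.
  rewrite derivD derivM derivX derivC addr0 mulr1 !hornerE /GRing.scale /=.
  ring.
elim/poly_ind: F => [|F c IHF].
  rewrite (_ : (fun t => _) = cst 0); last first.
    by apply/funext => s; rewrite /ev2 !horner0.
  by rewrite map_poly0 deriv0 /ev2 !horner0 !mul0r addr0; apply: is_derive_cst.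
rewrite (_ : (fun t => _) = (fun t => ev2 F (x t) (y t)) * y + (fun t => c.[x t])); last first.
  by apply/funext => s; rewrite /ev2 /= !hornerE.
apply: is_derive_eq (is_deriveD (is_deriveM IHF yP) (horner_derive c)) _.
have -> : map_poly (@deriv R) (F * 'X + c%:P) =
    map_poly (@deriv R) F * 'X + (c^`())%:P.
  apply/polyP => i; rewrite !(coefD, coefC, coefMX, coef_map_id0 _ _ (deriv0 R)).
  by case: i => [|i] /=; rewrite derivD ?deriv0 // ?add0r ?addr0.
rewrite derivD derivM derivX derivC addr0 mulr1 /ev2 !hornerE /GRing.scale /=.
ring.
Qed.
End Derivatives.

(** * The unit circle and its sample angles *)

Section UnitCircle.
Variable R : realType.
Implicit Types t : R.

Definition expi t : R[i] := (cos t +i* sin t)%C.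

Lemma expi_pow t n : expi t ^+ n = expi (n%:R * t).
Proof.
elim: n => [|n IHn]; first by rewrite mul0r /expi cos0 sin0.
rewrite exprS IHn /expi -natr1 mulrDl mul1r cosD sinD; simpc.
by congr (_ +i* _)%C; ring.
Qed.

Lemma expi_conjE t : expi t * (cos t +i* (- sin t))%C = 1.
Proof.
rewrite /expi; simpc; rewrite -!expr2 cos2Dsin2.
by congr (_ +i* _)%C; ring.
Qed.

Lemma expi_neq0 t : expi t != 0.
Proof.
by apply/eqP => e0; have /eqP := expi_conjE t; rewrite e0 mul0r eq_sym oner_eq0.
Qed.

Lemma expiV t : (expi t)^-1 = (cos t +i* (- sin t))%C.
Proof. by apply: (mulfI (expi_neq0 t)); rewrite expi_conjE mulfV ?expi_neq0. Qed.

(** An infinite supply of angles in [-pi, pi]; their cosines 1/(k+1) are distinct, hence so are the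
    points e^(it). *)
Definition circle_angle (k : nat) : R := acos (k.+1%:R^-1).

Lemma circle_angle_itv k : -1 <= (k.+1%:R^-1 : R) <= 1.
Proof.
rewrite (@le_trans _ _ 0) ?invr_ge0 ?ler0n ?lerN10 //=.
by rewrite invf_le1 ?ltr0n // ler1n.
Qed.

Lemma cos_circle_angle k : cos (circle_angle k) = k.+1%:R^-1.
Proof. by rewrite /circle_angle acosK // in_itv /= circle_angle_itv. Qed.

Lemma circle_angle_bound k : - pi <= circle_angle k <= pi.
Proof.
rewrite acos_lepi ?circle_angle_itv // andbT.
by apply: le_trans (acos_ge0 (circle_angle_itv k)); rewrite oppr_le0 pi_ge0.
Qed.

Lemma expi_circle_angle_inj : injective (expi \o circle_angle).
Proof.
move=> j k [] /=; rewrite !cos_circle_angle => /invr_inj/eqP.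
by rewrite eqr_nat => /eqP[].
Qed.

Lemma circle_point (c s : R) : c ^+ 2 + s ^+ 2 = 1 ->
  exists t, [/\ - pi <= t <= pi, cos t = c & sin t = s].
Proof.
move=> cs1; have c_itv : -1 <= c <= 1.
  by apply/andP; split; have := sqr_ge0 s; nra.
have sin_acosE : sin (acos c) = `|s|.
  by rewrite sin_acos // (_ : 1 - c ^+ 2 = s ^+ 2) ?sqrtr_sqr //; lra.
have acos_bound : - pi <= acos c <= pi.
  rewrite acos_lepi // andbT.
  by apply: le_trans (acos_ge0 c_itv); rewrite oppr_le0 pi_ge0.
case: (lerP 0 s) => s0.
  by exists (acos c); split; rewrite ?acosK ?in_itv //= sin_acosE ger0_norm.
exists (- acos c); split; rewrite ?cosN ?sinN ?acosK ?in_itv //=.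
  by move: acos_bound => /andP[? ?]; apply/andP; split; lra.
by rewrite sin_acosE ltr0_norm ?opprK.
Qed.

End UnitCircle.

(** * Laurent parametrization of the support curve *)

Section SupportCurve.
Variables (R : realType) (N : nat) (alpha : R) (a b : nat -> R).
Local Notation C := R[i].
Local Notation rc := (real_complex R).
Local Notation p := (trigp alpha N a b).
Local Notation freq k := ((2 * k + 1)%:R : R).
Implicit Types (t : R) (u : C).

Definition dtrigp t : R := \sum_(0 <= k < N.+1)
  (freq k * b k * cos (freq k * t) + - (freq k * a k) * sin (freq k * t)).
(** Closed form of p + p''; the velocity of the curve is this factor times (-sin t, cos t). *)
Definition curvature_radius t : R := alpha / 2 + \sum_(0 <= k < N.+1)
  (1 - freq k ^+ 2) * (a k * cos (freq k * t) + b k * sin (freq k * t)).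
Definition support_x t : R := p t * cos t - dtrigp t * sin t.
Definition support_y t : R := p t * sin t + dtrigp t * cos t.

Lemma is_derive_trig_sum (r s : nat -> R) t :
  is_derive t (1 : R)
    (fun t => \sum_(0 <= k < N.+1) (r k * cos (freq k * t) + s k * sin (freq k * t)))
    (\sum_(0 <= k < N.+1) (freq k * (s k * cos (freq k * t) - r k * sin (freq k * t)))).
Proof.
pose f k t := r k * cos (freq k * t) + s k * sin (freq k * t).
pose df k t := freq k * (s k * cos (freq k * t) - r k * sin (freq k * t)).
by apply: (@is_derive_sum_nat _ _ f df) => k; apply: is_derive_trig_term.
Qed.

Lemma is_derive_trigp t : is_derive t (1 : R) p (dtrigp t).
Proof.
have := is_derive_trig_sum a b t; move=> /(is_deriveD (is_derive_cst (alpha / 2) t 1)).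
by move=> /is_derive_eq; apply; rewrite add0r; apply: eq_bigr => k _; ring.
Qed.

Lemma derive1_trigp : derive1 p = dtrigp.
Proof.
by apply/funext => t; rewrite derive1E; have [_ ->] := is_derive_trigp t.
Qed.

Lemma is_derive_dtrigp t : is_derive t (1 : R) dtrigp (curvature_radius t - p t).
Proof.
apply: is_derive_eq (is_derive_trig_sum (fun k => freq k * b k)
  (fun k => - (freq k * a k)) t) _.
rewrite /curvature_radius /trigp opprD addrACA subrr add0r -sumrB.
by apply: eq_bigr => k _; ring.
Qed.

Lemma is_derive_support_x t :
  is_derive t (1 : R) support_x (- curvature_radius t * sin t).
Proof.
apply: is_derive_eq (is_deriveB (is_deriveM (is_derive_trigp t) (is_derive_cos t))
  (is_deriveM (is_derive_dtrigp t) (is_derive_sin t))) _.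
by rewrite /GRing.scale /=; ring.
Qed.

Lemma is_derive_support_y t :
  is_derive t (1 : R) support_y (curvature_radius t * cos t).
Proof.
apply: is_derive_eq (is_deriveD (is_deriveM (is_derive_trigp t) (is_derive_sin t))
  (is_deriveM (is_derive_dtrigp t) (is_derive_cos t))) _.
by rewrite /GRing.scale /=; ring.
Qed.

Definition half_coef k : C := (a k / 2 +i* (- b k / 2))%C.

(* The Laurent polynomials x + iy = (p + ip')u and x - iy in u = e^(it); the
   coefficient of u^(2k+1) in p is half_coef k. *)
Definition laurent_z u : C := rc (alpha / 2) * u + \sum_(k < N.+1)
  (rc (- (2 * k)%:R) * half_coef k * u ^+ (2 * k + 2) +
   rc (2 * k + 2)%:R * (half_coef k)^*%C * u^-1 ^+ (2 * k)).
Definition laurent_w u : C := rc (alpha / 2) * u^-1 + \sum_(k < N.+1)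
  (rc (- (2 * k)%:R) * (half_coef k)^*%C * u^-1 ^+ (2 * k + 2) +
   rc (2 * k + 2)%:R * half_coef k * u ^+ (2 * k)).

(** With m = 2k+1 and c = [half_coef k], the k-th harmonic of p is c u^m + conj(c) u^-m. As d/dt
    multiplies u^m by im, its share of p + ip' is (1-m) c u^m + (1+m) conj(c) u^-m; the factor u
    then gives the terms of [laurent_z]. *)
Lemma laurent_z_expi t : laurent_z (expi t) = (support_x t +i* support_y t)%C.
Proof.
pose f k := a k * cos (freq k * t) + b k * sin (freq k * t).
pose g k := freq k * b k * cos (freq k * t) + - (freq k * a k) * sin (freq k * t).
have termE k : rc (- (2 * k)%:R) * half_coef k * expi t ^+ (2 * k + 2) +
    rc (2 * k + 2)%:R * (half_coef k)^*%C * (expi t)^-1 ^+ (2 * k) =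
   (f k +i* g k)%C * expi t.
  have -> : (expi t)^-1 ^+ (2 * k) = (expi t ^+ (2 * k + 1))^-1 * expi t.
    by rewrite -exprVn addn1 exprSr mulfVK ?invr_neq0 ?expi_neq0 // mulrAC ?mulfK.
  have -> : expi t ^+ (2 * k + 2) = expi t ^+ (2 * k + 1) * expi t.
    by rewrite -exprSr -addnS.
  rewrite !mulrA -mulrDl expi_pow expiV /expi; congr (_ * _).
  by rewrite /half_coef /f /g; simpc; rewrite !natrD; congr (_ +i* _)%C; field.
have -> : (support_x t +i* support_y t)%C = (p t +i* dtrigp t)%C * expi t.
  by rewrite /expi; simpc.
rewrite /laurent_z; under eq_bigr do rewrite termE.
rewrite -mulr_suml -mulrDl; congr (_ * _).
have sumE n : \sum_(k < n) (f k +i* g k)%C =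
   ((\sum_(0 <= k < n) f k) +i* (\sum_(0 <= k < n) g k))%C.
  elim: n => [|n IHn]; first by rewrite big_ord0 !big_nil.
  by rewrite big_ord_recr /= IHn !big_nat_recr //=; simpc.
by rewrite sumE /trigp /dtrigp; simpc.
Qed.

Lemma conj_expi t : (expi t)^*%C = (expi t)^-1.
Proof. by rewrite expiV. Qed.

Lemma laurent_w_expi t : laurent_w (expi t) = (support_x t +i* (- support_y t))%C.
Proof.
have -> : (support_x t +i* - support_y t)%C = ((support_x t +i* support_y t)^*)%C by [].
have conjM (u v : C) : (u * v)^*%C = u^*%C * v^*%C by apply: rmorphM.
have conjX (u : C) n : (u ^+ n)^*%C = u^*%C ^+ n by apply: rmorphXn.
have conjD (u v : C) : (u + v)^*%C = u^*%C + v^*%C by apply: rmorphD.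
rewrite -laurent_z_expi /laurent_w /laurent_z conjD conjM conj_expi conjc_real.
congr (_ + _); rewrite rmorph_sum; apply: eq_bigr => k _.
rewrite [RHS]conjD !conjM !conjX conjc_inv conj_expi invrK conjcK.
by rewrite !conjc_real.
Qed.

Local Notation h := (N.+1).*2.

(** This is u^h z with h = 2N+2; the natural subtractions in the exponents are exact because k <=
    N. *)
Definition poly_z : {poly C} := rc (alpha / 2) *: 'X^(h + 1) + \sum_(k < N.+1)
  ((rc (- (2 * k)%:R) * half_coef k) *: 'X^(h + (2 * k + 2)) +
   (rc (2 * k + 2)%:R * (half_coef k)^*%C) *: 'X^(h - 2 * k)).
Definition poly_w : {poly C} := rc (alpha / 2) *: 'X^(h - 1) + \sum_(k < N.+1)
  ((rc (- (2 * k)%:R) * (half_coef k)^*%C) *: 'X^(h - (2 * k + 2)) +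
   (rc (2 * k + 2)%:R * half_coef k) *: 'X^(h + 2 * k)).

Lemma exprV_shift u n j : u != 0 -> (j <= n)%N -> u ^+ n * u^-1 ^+ j = u ^+ (n - j).
Proof.
by move=> u_neq0 le_jn; rewrite -{1}(subnK le_jn) exprD -mulrA -exprMn mulfV // expr1n mulr1.
Qed.

Lemma horner_poly_z u : u != 0 -> u ^+ h * laurent_z u = poly_z.[u].
Proof.
move=> u_neq0; rewrite /laurent_z /poly_z hornerD horner_sum mulrDr mulr_sumr.
congr (_ + _); first by rewrite hornerZ hornerXn exprD expr1 mulrCA.
apply: eq_bigr => k _; rewrite hornerD !hornerZ !hornerXn mulrDr.
rewrite (exprD u h) -(@exprV_shift u h (2 * k)) //; last by case: k => k /=; lia.
by congr (_ + _); rewrite mulrCA.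
Qed.

Lemma horner_poly_w u : u != 0 -> u ^+ h * laurent_w u = poly_w.[u].
Proof.
move=> u_neq0; rewrite /laurent_w /poly_w hornerD horner_sum mulrDr mulr_sumr.
congr (_ + _).
  by rewrite hornerZ hornerXn -(@exprV_shift u h 1) // expr1 mulrCA.
apply: eq_bigr => k _; rewrite hornerD !hornerZ !hornerXn mulrDr.
rewrite (exprD u h) -(@exprV_shift u h (2 * k + 2)) //; last by case: k => k /=; lia.
by congr (_ + _); rewrite mulrCA.
Qed.

Lemma size_scaleXn_le (e : C) n m : (n <= m)%N -> (size (e *: 'X^n) <= m.+1)%N.
Proof. by move=> le_nm; apply: leq_trans (size_scale_leq _ _) _; rewrite size_polyXn. Qed.

Lemma size_poly_z : (size poly_z <= h.*2.+1)%N.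
Proof.
apply: leq_trans (size_polyD _ _) _; rewrite geq_max size_scaleXn_le /=; last by lia.
apply: leq_trans (size_sum _ _ _) _; apply/bigmax_leqP => k _.
apply: leq_trans (size_polyD _ _) _.
by rewrite geq_max !size_scaleXn_le //; case: k => k /=; lia.
Qed.

Lemma size_poly_w : (size poly_w <= h.*2.+1)%N.
Proof.
apply: leq_trans (size_polyD _ _) _; rewrite geq_max size_scaleXn_le /=; last by lia.
apply: leq_trans (size_sum _ _ _) _; apply/bigmax_leqP => k _.
apply: leq_trans (size_polyD _ _) _.
by rewrite geq_max !size_scaleXn_le //; case: k => k /=; lia.
Qed.

Lemma coef_scaleXn_neq (e : C) n m : (m == n) = false -> (e *: 'X^n)`_m = 0.
Proof. by move=> neq; rewrite coefZ coefXn neq mulr0. Qed.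

(** Order 2N+2 is reached at infinity by z alone and at 0 by w alone, each through the index N;
    hence the extreme coefficients of a combination of z and w cannot cancel. *)
Lemma poly_z_top : poly_z`_(h.*2) = rc (- (2 * N)%:R) * half_coef N.
Proof.
rewrite /poly_z coefD coef_sum big_ord_recr /= big1 => [|k _]; last first.
  by rewrite coefD !coef_scaleXn_neq ?addr0 //; case: k => k /= ?; lia.
rewrite coefD ![(_ *: 'X^(_ + 1))`__]coef_scaleXn_neq; last by lia.
rewrite [(_ *: 'X^(h - _))`__]coef_scaleXn_neq; last by lia.
rewrite coefZ coefXn (_ : h.*2 == _) ?mulr1 ?addr0 ?add0r //; lia.
Qed.

Lemma poly_z_bottom : poly_z`_0 = 0.
Proof.
rewrite /poly_z coefD coef_sum big1 => [|k _].
  by rewrite addr0 coef_scaleXn_neq //; lia.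
by rewrite coefD !coef_scaleXn_neq ?addr0 //; case: k => k /= ?; lia.
Qed.

Lemma poly_w_top : poly_w`_(h.*2) = 0.
Proof.
rewrite /poly_w coefD coef_sum big1 => [|k _].
  by rewrite addr0 coef_scaleXn_neq //; lia.
by rewrite coefD !coef_scaleXn_neq ?addr0 //; case: k => k /= ?; lia.
Qed.

Lemma poly_w_bottom : poly_w`_0 = rc (- (2 * N)%:R) * (half_coef N)^*%C.
Proof.
rewrite /poly_w coefD coef_sum big_ord_recr /= big1 => [|k _]; last first.
  by rewrite coefD !coef_scaleXn_neq ?addr0 //; case: k => k /= ?; lia.
rewrite coefD ![(_ *: 'X^(_ - 1))`__]coef_scaleXn_neq; last by lia.
rewrite [(_ *: 'X^(h + _))`__]coef_scaleXn_neq; last by lia.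
rewrite coefZ coefXn (_ : 0%N == _) ?mulr1 ?addr0 ?add0r //; lia.
Qed.

Lemma expr_even_opp u n : (- u) ^+ (2 * n) = u ^+ (2 * n).
Proof. by rewrite !exprM sqrrN. Qed.

Lemma expr_even2_opp u n : (- u) ^+ (2 * n + 2) = u ^+ (2 * n + 2).
Proof. by rewrite (exprD (- u)) (exprD u) expr_even_opp sqrrN. Qed.

(** All exponents under the sum are even, so only alpha u / 2 changes sign. *)
Lemma laurent_z_opp u : laurent_z (- u) = laurent_z u - rc alpha * u.
Proof.
rewrite /laurent_z invrN; under eq_bigr do rewrite expr_even_opp expr_even2_opp.
rewrite addrAC; congr (_ + _); rewrite mulrN -mulrBl -rmorphB -mulNr -rmorphN.
by congr (rc _ * _); field.
Qed.

Lemma laurent_w_opp u : laurent_w (- u) = laurent_w u - rc alpha * u^-1.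
Proof.
rewrite /laurent_w invrN; under eq_bigr do rewrite expr_even_opp expr_even2_opp.
rewrite addrAC; congr (_ + _); rewrite mulrN -mulrBl -rmorphB -mulNr -rmorphN.
by congr (rc _ * _); field.
Qed.

(** The function p + p'' continued from the unit circle to nonzero complex u. *)
Definition laurent_curvature u : C := rc (alpha / 2) + \sum_(k < N.+1)
  rc (1 - freq k ^+ 2) *
    (half_coef k * u ^+ (2 * k + 1) + (half_coef k)^*%C * u^-1 ^+ (2 * k + 1)).

Lemma laurent_curvature_expi t :
  laurent_curvature (expi t) = rc (curvature_radius t).
Proof.
rewrite /laurent_curvature /curvature_radius rmorphD rmorph_sum big_mkord.
congr (_ + _); apply: eq_bigr => k _; rewrite [RHS]rmorphM; congr (_ * _).
rewrite exprVn expi_pow expiV /half_coef /expi; simpc.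
by congr (_ +i* _)%C; field.
Qed.

Lemma laurent_curvatureP : laurent (2 * N + 1) laurent_curvature.
Proof.
apply: laurentD; first exact: laurent_widen (laurent_cst _).
pose f (k : nat) u := rc (1 - freq k ^+ 2) *
    (half_coef k * u ^+ (2 * k + 1) + (half_coef k)^*%C * u^-1 ^+ (2 * k + 1)).
apply: (@laurent_sum _ _ _ f) => k ltk.
apply: laurentZ; apply: laurentD; apply: laurentZ.
  by apply: laurent_widen (laurentX (2 * k + 1) (laurent_id _)); lia.
by apply: laurent_widen (laurentX (2 * k + 1) (laurent_inv _)); lia.
Qed.

(** All nonconstant exponents are odd. This is the constant width relation: opposite radii of
    curvature add up to alpha. *)
Lemma laurent_curvature_opp u :
  laurent_curvature (- u) = rc alpha - laurent_curvature u.
Proof.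
have oddN (v : C) n : (- v) ^+ (2 * n + 1) = - v ^+ (2 * n + 1).
  by rewrite (exprD (- v)) (exprD v) expr_even_opp mulrN.
rewrite /laurent_curvature invrN opprD addrA -rmorphB.
congr (rc _ + _); first by field.
by rewrite -sumrN; apply: eq_bigr => k _; rewrite !oddN; ring.
Qed.

(* The real linear form r x + s y, with z = x + iy and w = x - iy. *)
Definition real_form (r s : R) u : C :=
  (r / 2 +i* (- s / 2))%C * laurent_z u + (r / 2 +i* (s / 2))%C * laurent_w u.

Lemma real_form_expi r s t :
  real_form r s (expi t) = rc (r * support_x t + s * support_y t).
Proof.
rewrite /real_form laurent_z_expi laurent_w_expi; simpc.
by congr (_ +i* _)%C; field.
Qed.

Definition real_form_poly (r s : R) : {poly C} :=
  (r / 2 +i* (- s / 2))%C *: poly_z + (r / 2 +i* (s / 2))%C *: poly_w.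

Lemma horner_real_form r s u : u != 0 ->
  u ^+ h * real_form r s u = (real_form_poly r s).[u].
Proof.
move=> u_neq0; rewrite /real_form /real_form_poly hornerD !hornerZ.
by rewrite -horner_poly_z // -horner_poly_w // mulrDr; congr (_ + _); rewrite mulrCA.
Qed.

Lemma size_real_form_poly_le r s : (size (real_form_poly r s) <= h.*2.+1)%N.
Proof.
apply: leq_trans (size_polyD _ _) _; rewrite geq_max.
by rewrite !(leq_trans (size_scale_leq _ _)) ?size_poly_z ?size_poly_w.
Qed.

Lemma laurent_real_form r s : laurent h (real_form r s).
Proof.
exists (real_form_poly r s); first exact: size_real_form_poly_le.
by move=> u; apply: horner_real_form.
Qed.

Lemma complex_neq0 (r s : R) : (r != 0) || (s != 0) -> (r +i* s)%C != 0.
Proof. by rewrite eq_complex /= negb_and. Qed.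

(** * Degree of the equation for N > 0 *)

Section NonCircular.
Hypotheses (N_gt0 : (0 < N)%N) (ab_neq0 : (a N != 0) || (b N != 0)).

Lemma half_coef_neq0 : half_coef N != 0.
Proof. by apply: complex_neq0; rewrite !mulf_eq0 !oppr_eq0 !invr_eq0 !pnatr_eq0 !orbF. Qed.

Let top_neq0 : rc (- (2 * N)%:R) != 0.
Proof. by rewrite fmorph_eq0 oppr_eq0 pnatr_eq0; lia. Qed.

(** The top coefficient is (r - is)/2 times -2N times [half_coef N]; for real r, s the first factor
    vanishes only at r = s = 0. *)
Lemma size_real_form_poly r s : (r != 0) || (s != 0) ->
  size (real_form_poly r s) = h.*2.+1.
Proof.
move=> rs_neq0; apply/eqP; rewrite eqn_leq size_real_form_poly_le /= ltnNge.
apply/negP => /(nth_default 0) /eqP; apply/negP.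
rewrite coefD !coefZ poly_z_top poly_w_top mulr0 addr0 !mulf_neq0 ?half_coef_neq0 //.
by apply: complex_neq0; rewrite !mulf_eq0 !oppr_eq0 !invr_eq0 !pnatr_eq0 !orbF.
Qed.

Lemma real_form_poly0 r s : (r != 0) || (s != 0) -> (real_form_poly r s).[0] != 0.
Proof.
move=> rs_neq0; rewrite horner_coef0 coefD !coefZ poly_z_bottom poly_w_bottom.
rewrite mulr0 add0r !mulf_neq0 ?conjc_eq0 ?half_coef_neq0 //.
by apply: complex_neq0; rewrite !mulf_eq0 !invr_eq0 !pnatr_eq0 !orbF.
Qed.

Hypothesis alpha_neq0 : alpha != 0.
Variables (r1 s1 r2 s2 : R).
Hypothesis det_neq0 : r1 * s2 - s1 * r2 != 0.
Local Notation X := (real_form r1 s1).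
Local Notation Y := (real_form r2 s2).
Local Notation lift := (map_poly (map_poly rc)).
(** [l1], [l1'] are the coefficients of z and w in X, and [l2], [l2'] those in Y. *)
Let l1 : C := (r1 / 2 +i* (- s1 / 2))%C.
Let l1' : C := (r1 / 2 +i* (s1 / 2))%C.
Let l2 : C := (r2 / 2 +i* (- s2 / 2))%C.
Let l2' : C := (r2 / 2 +i* (s2 / 2))%C.

Lemma complex_det_neq0 : l1 * l2' - l1' * l2 != 0.
Proof.
rewrite (_ : _ - _ = (0 +i* ((r1 * s2 - s1 * r2) / 2))%C); last first.
  by rewrite /l1 /l1' /l2 /l2'; simpc; congr (_ +i* _)%C; field.
by apply: complex_neq0; rewrite mulf_eq0 invr_eq0 pnatr_eq0 orbF det_neq0 orbT.
Qed.

Variable F : {poly {poly R}}.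
Hypothesis F_neq0 : F != 0.
Hypothesis F_irr : forall G H, F = G * H -> (size G <= 1)%N \/ (size H <= 1)%N.
Hypothesis F_curve : forall t, - pi <= t <= pi ->
  ev2 F (r1 * support_x t + s1 * support_y t) (r2 * support_x t + s2 * support_y t) = 0.

Let rs1_neq0 : (r1 != 0) || (s1 != 0).
Proof.
rewrite -negb_and; apply: contra det_neq0 => /andP[/eqP -> /eqP ->].
by rewrite !mul0r subrr.
Qed.

Let pt := @expi R \o @circle_angle R.
Let xr k := r1 * support_x (circle_angle R k) + s1 * support_y (circle_angle R k).
Let yr k := r2 * support_x (circle_angle R k) + s2 * support_y (circle_angle R k).
Let pt_inj : injective pt := @expi_circle_angle_inj R.
Let pt_neq0 k : pt k != 0. Proof. exact: expi_neq0. Qed.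
Let ptX k : X (pt k) = rc (xr k). Proof. exact: real_form_expi. Qed.
Let ptY k : Y (pt k) = rc (yr k). Proof. exact: real_form_expi. Qed.
Let h_gt0 : (0 < h)%N. Proof. by rewrite double_gt0. Qed.

Lemma curve_vanish u : u != 0 -> ev2 (lift F) (X u) (Y u) = 0.
Proof.
apply: (vanish_real (size_real_form_poly rs1_neq0) (horner_real_form r1 s1)
  (laurent_real_form r2 s2) pt_inj pt_neq0 ptX ptY) => k.
exact/F_curve/circle_angle_bound.
Qed.

(** Passing through complex u extends the vanishing from [-pi, pi] to every real t, so that it can
    be differentiated. *)
Lemma curve_vanish_real t :
  ev2 F (r1 * support_x t + s1 * support_y t) (r2 * support_x t + s2 * support_y t) = 0.
Proof.
have := curve_vanish (expi_neq0 t); rewrite !real_form_expi ev2_lift => /eqP.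
by rewrite fmorph_eq0 => /eqP.
Qed.

(* The tangent of the curve at parameter t is orthogonal to (cos t, sin t), so
   differentiating F along the curve determines u^2 from the gradient of F. *)
Lemma curve_gradient u : u != 0 ->
  ev2 (lift (map_poly (@deriv R) F)) (X u) (Y u) * (l1 * u - l1' * u^-1) +
  ev2 (lift F^`()) (X u) (Y u) * (l2 * u - l2' * u^-1) = 0.
Proof.
have lX := laurent_real_form r1 s1; have lY := laurent_real_form r2 s2.
have [d1 lF1] := laurent_ev2_ex (lift (map_poly (@deriv R) F)) lX lY.
have [d2 lF2] := laurent_ev2_ex (lift F^`()) lX lY.
have ldir (e e' : C) : laurent 1 (fun u => e * u - e' * u^-1).
  have := laurentD (laurentZ e (laurent_id C)) (laurentZ (- e') (laurent_inv C)).
  by move=> [P szP PE]; exists P => // v /PE <-; rewrite mulNr.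
pose S u := ev2 (lift (map_poly (@deriv R) F)) (X u) (Y u) * (l1 * u - l1' * u^-1) +
  ev2 (lift F^`()) (X u) (Y u) * (l2 * u - l2' * u^-1).
have lS : laurent ((d1 + d2).+1) S.
  apply: laurentD.
    by apply: laurent_widen (laurentM lF1 (ldir l1 l1')); lia.
  by apply: laurent_widen (laurentM lF2 (ldir l2 l2')); lia.
have lrho := laurent_curvatureP.
(* The values at 1 and -1 add up to alpha, so one of them is nonzero. *)
have [v v_neq0 rho_v] : exists2 v, v != 0 & laurent_curvature v != 0.
  have [rho1|] := eqVneq (laurent_curvature 1) 0; last by exists 1; rewrite ?oner_eq0.
  exists (- 1); first by rewrite oppr_eq0 oner_eq0.
  by rewrite laurent_curvature_opp rho1 subr0 fmorph_eq0.
(* Differentiation only shows that [S] times the radius of curvature is 0 at the sample points; the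
   product is then identically 0 and the nonzero factor cancels. *)
apply: (@laurentM_eq0 C _ _ _ _ v lrho lS) => //.
have lrS := laurentM lrho lS.
set d := (_ + _)%N in lrS.
apply: (@laurent_eq0 _ d _ [seq pt k | k <- iota 0 d.*2.+1]) => //.
- by rewrite map_inj_uniq ?iota_uniq.
- by rewrite size_map size_iota.
move=> _ /mapP[k _ ->]; split; first exact: pt_neq0.
set t := circle_angle R k; rewrite /pt /= -/t.
(* The factor i makes the direction real on the unit circle; times the radius of curvature it is the
   derivative of r x + s y. *)
have dirE (r s : R) : (0 +i* 1)%C *
    ((r / 2 +i* (- s / 2))%C * expi t - (r / 2 +i* (s / 2))%C * (expi t)^-1) =
    rc (r * - sin t + s * cos t).
  by rewrite expiV /expi; simpc; congr (_ +i* _)%C; field.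
have i_neq0 : (0 +i* 1)%C != 0 :> C by apply: complex_neq0; rewrite oner_eq0 orbT.
apply: (mulfI i_neq0); rewrite mulr0 mulrCA /S mulrDr.
rewrite [_ * (_ * (l1 * _ - _))]mulrCA [_ * (_ * (l2 * _ - _))]mulrCA !dirE.
rewrite laurent_curvature_expi !real_form_expi !ev2_lift -!rmorphM -rmorphD -rmorphM.
have dform (r s : R) : is_derive t (1 : R)
    (fun t => r * support_x t + s * support_y t)
    (curvature_radius t * (r * - sin t + s * cos t)).
  apply: is_derive_eq (is_deriveD (is_deriveZ r (is_derive_support_x t))
    (is_deriveZ s (is_derive_support_y t))) _.
  by rewrite /GRing.scale /=; ring.
have [_] := is_derive_ev2 F (dform r1 s1) (dform r2 s2).
rewrite (_ : (fun t => _) = cst 0) ?derive_cst; last first.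
  by apply/funext => t'; apply: curve_vanish_real.
move=> dF; apply/eqP; rewrite fmorph_eq0; apply/eqP; rewrite dF; ring.
Qed.

(** The gradient of F is the same at u and v, so [curve_gradient] gives u^2 = v^2; the case u = -v
    is excluded by the odd terms of X and Y. *)
Lemma curve_param_inj u v : u != 0 -> v != 0 -> X u = X v -> Y u = Y v ->
  ev2 (lift F^`()) (X u) (Y u) != 0 -> u = v.
Proof.
move=> u_neq0 v_neq0 Xuv Yuv Fy.
have gu := curve_gradient u_neq0; have := curve_gradient v_neq0.
rewrite -Xuv -Yuv => gv; move: gu gv Fy.
set fx := ev2 _ _ _; set fy := ev2 _ _ _ => gu gv fy_neq0.
have det := complex_det_neq0.
have sq (w : C) : w != 0 -> fx * (l1 * w - l1' * w^-1) + fy * (l2 * w - l2' * w^-1) = 0 ->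
    (fx * l1 + fy * l2) * w ^+ 2 = fx * l1' + fy * l2'.
  move=> w_neq0 gw; apply/eqP; rewrite -subr_eq0; apply/eqP.
  by rewrite -[RHS](mulr0 w) -gw; field.
have gu2 := sq u u_neq0 gu; have gv2 := sq v v_neq0 gv.
(* If this vanished, so would fx l1' + fy l2', and the nonzero determinant would force fy = 0. *)
have g_neq0 : fx * l1 + fy * l2 != 0.
  apply: contra_neq fy_neq0 => g0; move: gu2; rewrite g0 mul0r => /esym g0'.
  apply: (mulfI det); rewrite mulr0.
  transitivity (l1 * (fx * l1' + fy * l2') - l1' * (fx * l1 + fy * l2)); first by ring.
  by rewrite g0 g0' !mulr0 subr0.
have /eqP : u ^+ 2 = v ^+ 2 by apply: (mulfI g_neq0); rewrite gu2 gv2.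
rewrite eqf_sqr => /orP[/eqP //|/eqP uE]; exfalso.
(* Equal values of a form at v and -v leave alpha (e v + e'/v) = 0. For X and Y together this makes
   (l1', l2') proportional to (l1, l2), against the determinant. *)
have form_opp r s : real_form r s u = real_form r s v ->
    (r / 2 +i* (- s / 2))%C * v ^+ 2 = - (r / 2 +i* (s / 2))%C.
  rewrite uE /real_form laurent_z_opp laurent_w_opp.
  set e := (_ +i* _)%C; set e' := (_ +i* _)%C => eq_form.
  have rca : rc alpha != 0 by rewrite fmorph_eq0.
  apply: (mulfI rca); apply/eqP; rewrite mulrN -addr_eq0; apply/eqP.
  transitivity (v * (e * laurent_z v + e' * laurent_w v - (e * (laurent_z v - rc alpha * v) +
    e' * (laurent_w v - rc alpha / v)))).
    by field.
  by rewrite eq_form subrr mulr0.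
have e1 := form_opp _ _ Xuv; have e2 := form_opp _ _ Yuv.
case/eqP: det; rewrite -[l2']opprK -[l1']opprK -[- l2']e2 -[- l1']e1 /l1 /l2; ring.
Qed.

Lemma size_support_poly : size F = (4 * N + 5)%N.
Proof.
rewrite (vanish_size_eq h_gt0 (size_real_form_poly rs1_neq0) (real_form_poly0 rs1_neq0)
  (horner_real_form r1 s1) (laurent_real_form r2 s2) pt_inj pt_neq0 ptX ptY F_neq0
  curve_vanish F_irr curve_param_inj); lia.
Qed.

End NonCircular.
End SupportCurve.

(** * Degrees of the defining polynomial *)

Lemma pdeg_le_totdeg (R : realType) i (f : bipoly R) : (pdeg i f <= totdeg f)%N.
Proof.
apply/bigmax_leqP_seq => m m_supp _.
apply: leq_trans (leq_bigmax_seq (F := @mpoly.mdeg 2) _ m_supp isT).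
by rewrite mpoly.mdegE (bigD1 i) //= leq_addr.
Qed.

Lemma support_curve_trigp_point (R : realType) N (alpha : R) a b t :
    - pi <= t <= pi ->
  support_curve (trigp alpha N a b) (support_x N alpha a b t, support_y N alpha a b t).
Proof.
by move=> t_itv; exists t => /=; rewrite ?derive1_trigp // in_itv.
Qed.

(** The first harmonic of a support function only translates the curve, here a circle of radius
    alpha/2 moved to centre (a_1, b_1). *)
Lemma is_circle_support_curve0 (R : realType) (alpha : R) a b :
  0 < alpha -> is_circle (support_curve (trigp alpha 0 a b)).
Proof.
move=> alpha_gt0; exists (a 0%N, b 0%N), (alpha / 2); split; first exact: divr_gt0.
have pE t : trigp alpha 0 a b t = alpha / 2 + (a 0%N * cos t + b 0%N * sin t).
  by rewrite /trigp big_nat1 muln0 add0n mul1r.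
have dpE t : derive1 (trigp alpha 0 a b) t = b 0%N * cos t - a 0%N * sin t.
  by rewrite derive1_trigp /dtrigp big_nat1 muln0 add0n !mul1r mulNr.
have r_neq0 : alpha / 2 != 0 by rewrite gt_eqF ?divr_gt0.
pose r := alpha / 2; rewrite -/r in pE r_neq0 *.
have xE t : trigp alpha 0 a b t * cos t - derive1 (trigp alpha 0 a b) t * sin t =
    r * cos t + a 0%N.
  rewrite -[a 0%N in RHS]mulr1 -(cos2Dsin2 t) dpE pE; ring.
have yE t : trigp alpha 0 a b t * sin t + derive1 (trigp alpha 0 a b) t * cos t =
    r * sin t + b 0%N.
  rewrite -[b 0%N in RHS]mulr1 -(cos2Dsin2 t) dpE pE; ring.
apply/seteqP; split=> [_ [t _ ->]|[x y] /= xyP] /=.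
  by rewrite xE yE !addrK !exprMn -mulrDr cos2Dsin2 mulr1.
have [|t [t_itv tc ts]] := @circle_point R ((x - a 0%N) / r) ((y - b 0%N) / r).
  by rewrite 2!(expr_div_n _ r) -mulrDl xyP -expr_div_n divff ?expr1n.
exists t; first by rewrite /= in_itv.
by rewrite xE yE tc ts; congr (_, _); field.
Qed.

Lemma size_lin_subst (R : realType) N (alpha : R) a b (f : bipoly R) (c11 c12 c21 c22 : R) :
    0 < alpha -> (0 < N)%N -> a N != 0 \/ b N != 0 ->
    defining_poly (support_curve (trigp alpha N a b)) f ->
    c11 * c22 - c12 * c21 != 0 ->
  size (lin_subst c11 c12 c21 c22 f) = (4 * N + 5)%N.
Proof.
move=> alpha_gt0 N_gt0 /orP ab_neq0 [f_irr f_zero] det_neq0.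
set D := _ - _ in det_neq0.
have f_neq0 : f != 0.
  apply: contraPneq f_irr => ->; case.
  by rewrite /totdeg mpoly.msupp0 big_nil.
(* The inverse matrix expresses the new coordinates X, Y through x, y. *)
apply: (@size_support_poly R N alpha a b N_gt0 ab_neq0 _ (c22 / D) (- c12 / D)
    (- c21 / D) (c11 / D)).
- by rewrite gt_eqF.
- rewrite (_ : _ - _ = D^-1) ?invr_eq0 //.
  by rewrite /D; field.
- exact: lin_subst_neq0.
- exact: lin_subst_irreducible.
move=> t t_itv; rewrite ev2_lin_subst.
have : [set z | bieval f z = 0]%classic (support_x N alpha a b t, support_y N alpha a b t).
  by rewrite f_zero => g; apply; apply: support_curve_trigp_point.
by move=> /= <-; congr (bieval f (_, _)); rewrite /D; field.
Qed.

Theorem theorem2p6 (R : realType) (N : nat) (alpha : R) (a b : nat -> R) :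
  0 < alpha ->
  (forall t : R, 0 <= trigp alpha N a b t + derive1 (derive1 (trigp alpha N a b)) t) ->
  (a N != 0 \/ b N != 0) ->
  ~ is_circle (support_curve (trigp alpha N a b)) ->
  forall f : bipoly R, defining_poly (support_curve (trigp alpha N a b)) f ->
    totdeg f = (4 * N + 4)%N /\ deg_x f = (4 * N + 4)%N /\ deg_y f = (4 * N + 4)%N.
Proof.
move=> alpha_gt0 _ ab_neq0 not_circle f f_def.
have N_gt0 : (0 < N)%N.
  rewrite lt0n; apply/eqP => N0; apply: not_circle; rewrite N0.
  exact: is_circle_support_curve0.
have size_subst c11 c12 c21 c22 := @size_lin_subst R N alpha a b f c11 c12 c21 c22
  alpha_gt0 N_gt0 ab_neq0 f_def.
have sizeC (e : {poly R}) : (size e%:P <= 1)%N by apply: size_polyC_leq1.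
have size_lin (c e : {poly R}) : (size (c%:P + e *: 'X)%R <= 2)%N.
  rewrite addrC -mul_polyC; apply: leq_trans (size_polyD _ _) _.
  rewrite geq_max (leq_trans (sizeC c)) // andbT mul_polyC.
  by rewrite (leq_trans (size_scale_leq _ _)) // size_polyX.
(* Identity coordinates: the outer variable is y. *)
have degy_ge : (4 * N + 4 <= deg_y f)%N.
  have := size_subst 1 0 0 1; rewrite mulr1 mul0r subr0 oner_eq0 => /(_ isT) size_eq.
  rewrite -ltnS -addnS -size_eq; apply: size_mmap_le => k.
  rewrite /pairfun; case: k => -[|[|//]] ltk /=; last exact: size_lin.
  by rewrite polyC0 scale0r addr0 (leq_trans (sizeC _)).
(* Swapped coordinates: the outer variable is x. *)
have degx_ge : (4 * N + 4 <= deg_x f)%N.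
  have := size_subst 0 1 1 0; rewrite mulr0 mulr1 sub0r oppr_eq0 oner_eq0.
  move=> /(_ isT) size_eq; rewrite -ltnS -addnS -size_eq; apply: size_mmap_le => k.
  rewrite /pairfun; case: k => -[|[|//]] ltk /=; first exact: size_lin.
  by rewrite polyC0 scale0r addr0 (leq_trans (sizeC _)).
(* A generic shear has outer degree at least the total degree, yet its size is 4N+5 as in all linear
   coordinates. *)
have tot_le : (totdeg f <= 4 * N + 4)%N.
  have f_neq0 : f != 0.
    by apply: contraTneq degy_ge => ->; rewrite /deg_y /pdeg mpoly.msupp0 big_nil addnS.
  have [t] := totdeg_lt_size_shear f_neq0.
  by rewrite size_subst ?mulr1 ?mulr0 ?subr0 ?oner_eq0 // addnS.
have degx_le := pdeg_le_totdeg (@ord0 1) f.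
have degy_le := pdeg_le_totdeg (@ord_max 1) f.
rewrite /deg_x /deg_y in degx_ge degy_ge *.
by split; [|split]; apply/eqP; rewrite eqn_leq; apply/andP; split; lia.
Qed.
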